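(* For a semiring $R$, the following conditions are equivalent: (i) $R$ is a simple semiring with an infinite element; (ii) $R$ is Morita equivalent to the Boolean semiring $\mathbf{B}$; (iii) $R\cong\mathbf{E}_M$, where $M$ is a nonzero finite distributive lattice; (iv) $R$ is a complete simple semiring.
   Context: A semiring $(R,+,\cdot,0,1)$ consists of a commutative monoid $(R,+,0)$ and a monoid $(R,\cdot,1)$ such that multiplication distributes over addition on both sides and $0r=0=r0$ for all $r\in R$. An ideal is an additive submonoid closed under left and right multiplication by elements of $R$. $R$ is ideal-simple if $0$ and $R$ are its only ideals; congruence-simple if the diagonal and $R^2$ are its only congruences; simple if it is both. An infinite element is an element $\infty\in R$ with $r+\infty=\infty$ for all $r\in R$. $\mathbf{B}=\{0,1\}$ is the Boolean semiring ($1+1=1$). Semirings $R,S$ are Morita equivalent if their categories of (unital) left semimodules are equivalent, where a left $R$-semimodule is a commutative monoid $M$ with a unital, associative scalar multiplication $R\times M\to M$ that is additive in each variable and satisfies $r0_M=0_M=0m$. For a lattice $M$ with least element $0$, $\mathbf{E}_M$ is the semiring of all endomorphisms of the monoid $(M,\vee,0)$ with pointwise addition (join) and composition as multiplication; $M$ is nonzero if $M\neq\{0\}$. A semiring $R$ is complete if for every index set $\Omega$ and every family $(m_i)_{i\in\Omega}$ in $R$ there is defined an element $\sum_{i\in\Omega}m_i\in R$ such that: the sum over $\emptyset$ is $0$; $\sum_{i\in\{1\}}m_i=m_1$; $\sum_{i\in\{1,2\}}m_i=m_1+m_2$; $\sum_{i\in\Omega}m_i=\sum_{j\in\Lambda}\big(\sum_{i\in\Omega_j}m_i\big)$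 for every partition $\Omega=\bigcup_{j\in\Lambda}\Omega_j$ into disjoint nonempty subsets; and $r\big(\sum_i m_i\big)=\sum_i rm_i$, $\big(\sum_i m_i\big)r=\sum_i m_ir$ for all $r\in R$. In (iv), ''complete simple semiring'' means a simple semiring that carries such a summation. *)

(* Defs.v *)
From HB Require Import structures.
From mathcomp Require Import all_boot all_order all_algebra.
From mathcomp Require Import boolp classical_sets.
Set Implicit Arguments.
Unset Strict Implicit.
Unset Printing Implicit Defensive.
Import Order.TTheory GRing.Theory.
Local Open Scope classical_set_scope.
Local Open Scope ring_scope.

(* Semirings are [pzSemiRingType]: not necessarily commutative, and 0 = 1 is
   allowed. *)

Section Simpleness.
Variable R : pzSemiRingType.

Definition is_ideal (I : set R) : Prop :=
  [/\ I 0,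
      (forall x y, I x -> I y -> I (x + y)),
      (forall r x, I x -> I (r * x)) &
      (forall r x, I x -> I (x * r))].

Definition ideal_simple : Prop :=
  forall I : set R, is_ideal I -> I = [set 0] \/ I = setT.

Definition is_congruence (rho : R -> R -> Prop) : Prop :=
  [/\ (forall x, rho x x),
      (forall x y, rho x y -> rho y x),
      (forall x y z, rho x y -> rho y z -> rho x z),
      (forall x x' y y', rho x x' -> rho y y' -> rho (x + y) (x' + y')) &
      (forall x x' y y', rho x x' -> rho y y' -> rho (x * y) (x' * y'))].

Definition congruence_simple : Prop :=
  forall rho : R -> R -> Prop, is_congruence rho ->
    (forall x y, rho x y <-> x = y) \/ (forall x y, rho x y).

(* As usual for simple objects, the one-element semiring is not counted as
   simple: {0} and R are two different ideals. *)
Definition simple_semiring : Prop :=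
  [/\ (1 : R) <> 0, ideal_simple & congruence_simple].

Definition is_infinite (infty : R) : Prop := forall r : R, r + infty = infty.

End Simpleness.

Section Completeness.
Variable R : pzSemiRingType.

Definition is_partition (Omega Lambda : Type) (P : Lambda -> set Omega) : Prop :=
  [/\ (forall j, P j !=set0), trivIset setT P & \bigcup_j P j = setT].

(* The index sets {1} and {1, 2} are represented by [unit] and [bool]. The type
   [P j] of the inner sums is the subtype of the elements of the block [P j]. *)
Record is_summation (sum : forall Omega : Type, (Omega -> R) -> R) : Prop :=
  IsSummation {
    sum_empty : forall m : void -> R, sum void m = 0;
    sum_single : forall m : unit -> R, sum unit m = m tt;
    sum_pair : forall m : bool -> R, sum bool m = m false + m true;
    sum_partition : forall (Omega Lambda : Type) (P : Lambda -> set Omega)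
        (m : Omega -> R), is_partition P ->
      sum Omega m = sum Lambda (fun j => sum (P j) (fun i : P j => m (val i)));
    sum_distrr : forall (Omega : Type) (r : R) (m : Omega -> R),
      r * sum Omega m = sum Omega (fun i => r * m i);
    sum_distrl : forall (Omega : Type) (r : R) (m : Omega -> R),
      sum Omega m * r = sum Omega (fun i => m i * r)
  }.

Definition complete_semiring : Prop :=
  exists sum : forall Omega : Type, (Omega -> R) -> R, is_summation sum.

End Completeness.

Definition semiring_iso (R S : pzSemiRingType) : Prop :=
  exists f : {rmorphism R -> S}, bijective f.

(* A copy of [bool], because MathComp already equips [bool] itself with the
   field structure of F_2. *)
Definition boolean : Type := bool.
HB.instance Definition _ := Choice.on boolean.
HB.instance Definition _ := GRing.isPzSemiRing.Build boolean
  orbA orbC orFb andbA andTb andbT andb_orl andb_orr andFb andbF.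

Section JoinEndomorphisms.
Context {d : Order.disp_t} (M : bLatticeType d).
Import Order.Def.

Record join_endo := JoinEndo {
  join_endo_fun :> M -> M;
  join_endo0 : join_endo_fun \bot%O = \bot%O;
  join_endoU : forall x y : M,
    join_endo_fun (x `|` y)%O = (join_endo_fun x `|` join_endo_fun y)%O
}.

Lemma join_endo_ext (f g : join_endo) : f =1 g -> f = g.
Proof.
case: f g => [f f0 fU] [g g0 gU] /= /funext fg.
by case: g / fg g0 gU => g0 gU; congr JoinEndo; apply: Prop_irrelevance.
Qed.

HB.instance Definition _ := gen_eqMixin join_endo.
HB.instance Definition _ := gen_choiceMixin join_endo.

Definition endo_zero : join_endo :=
  @JoinEndo (fun=> \bot%O) erefl (fun _ _ => esym (joinxx _)).

Fact endo_add0 (f g : join_endo) : (f \bot `|` g \bot)%O = \bot%O :> M.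
Proof. by rewrite !join_endo0 joinxx. Qed.
Fact endo_addU (f g : join_endo) (x y : M) :
  (f (x `|` y) `|` g (x `|` y) = (f x `|` g x) `|` (f y `|` g y))%O.
Proof. by rewrite !join_endoU joinACA. Qed.
Definition endo_add (f g : join_endo) : join_endo :=
  JoinEndo (endo_add0 f g) (endo_addU f g).

Definition endo_one : join_endo := @JoinEndo id erefl (fun _ _ => erefl).

Fact endo_mul0 (f g : join_endo) : f (g \bot%O) = \bot%O.
Proof. by rewrite !join_endo0. Qed.
Fact endo_mulU (f g : join_endo) (x y : M) :
  (f (g (x `|` y)) = f (g x) `|` f (g y))%O.
Proof. by rewrite !join_endoU. Qed.
Definition endo_mul (f g : join_endo) : join_endo :=
  JoinEndo (endo_mul0 f g) (endo_mulU f g).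

Fact endo_addA : associative endo_add.
Proof. by move=> f g h; apply: join_endo_ext => x; apply: joinA. Qed.
Fact endo_addC : commutative endo_add.
Proof. by move=> f g; apply: join_endo_ext => x; apply: joinC. Qed.
Fact endo_add0r : left_id endo_zero endo_add.
Proof. by move=> f; apply: join_endo_ext => x; apply: join0x. Qed.
Fact endo_mulA : associative endo_mul.
Proof. by move=> f g h; apply: join_endo_ext. Qed.
Fact endo_mul1r : left_id endo_one endo_mul.
Proof. by move=> f; apply: join_endo_ext. Qed.
Fact endo_mulr1 : right_id endo_one endo_mul.
Proof. by move=> f; apply: join_endo_ext. Qed.
Fact endo_mulDl : left_distributive endo_mul endo_add.
Proof. by move=> f g h; apply: join_endo_ext. Qed.
Fact endo_mulDr : right_distributive endo_mul endo_add.
Proof. by move=> f g h; apply: join_endo_ext => x; apply: join_endoU. Qed.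
Fact endo_mul0r : left_zero endo_zero endo_mul.
Proof. by move=> f; apply: join_endo_ext. Qed.
Fact endo_mulr0 : right_zero endo_zero endo_mul.
Proof. by move=> f; apply: join_endo_ext => x; apply: join_endo0. Qed.

HB.instance Definition _ := GRing.isPzSemiRing.Build join_endo
  endo_addA endo_addC endo_add0r endo_mulA endo_mul1r endo_mulr1
  endo_mulDl endo_mulDr endo_mul0r endo_mulr0.

End JoinEndomorphisms.

Record category := Category {
  obj :> Type;
  mor : obj -> obj -> Type;
  mor_id : forall A, mor A A;
  mor_comp : forall A B C, mor B C -> mor A B -> mor A C;
  mor_compA : forall A B C D (h : mor C D) (g : mor B C) (f : mor A B),
    mor_comp h (mor_comp g f) = mor_comp (mor_comp h g) f;
  mor_comp1m : forall A B (f : mor A B), mor_comp (mor_id B) f = f;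
  mor_compm1 : forall A B (f : mor A B), mor_comp f (mor_id A) = f
}.
Arguments mor_id {c} A.

Record functor (C D : category) := Functor {
  fobj :> C -> D;
  fmap : forall A B : C, mor A B -> mor (fobj A) (fobj B);
  fmap1 : forall A : C, fmap (mor_id A) = mor_id (fobj A);
  fmapM : forall (A B E : C) (g : mor B E) (f : mor A B),
    fmap (mor_comp g f) = mor_comp (fmap g) (fmap f)
}.

Definition functor_id (C : category) : functor C C :=
  @Functor C C id (fun _ _ => id) (fun _ => erefl) (fun _ _ _ _ _ => erefl).

Section FunctorComp.
Variables (C D E : category) (G : functor D E) (F : functor C D).

Fact functor_comp1 (A : C) : fmap G (fmap F (mor_id A)) = mor_id (G (F A)).
Proof. by rewrite !fmap1. Qed.
Fact functor_compM (A B B' : C) (g : mor B B') (f : mor A B) :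
  fmap G (fmap F (mor_comp g f)) = mor_comp (fmap G (fmap F g)) (fmap G (fmap F f)).
Proof. by rewrite !fmapM. Qed.

Definition functor_comp : functor C E :=
  @Functor C E (fun A => G (F A)) (fun _ _ f => fmap G (fmap F f))
    functor_comp1 functor_compM.
End FunctorComp.

Definition is_isom (C : category) (A B : C) (f : mor A B) : Prop :=
  exists g : mor B A, mor_comp g f = mor_id A /\ mor_comp f g = mor_id B.

Definition naturally_isomorphic (C D : category) (F G : functor C D) : Prop :=
  exists phi : forall A : C, mor (F A) (G A),
    (forall (A B : C) (f : mor A B),
       mor_comp (phi B) (fmap F f) = mor_comp (fmap G f) (phi A)) /\
    (forall A : C, is_isom (phi A)).

Definition equivalent_categories (C D : category) : Prop :=
  exists (F : functor C D) (G : functor D C),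
    naturally_isomorphic (functor_comp G F) (functor_id C) /\
    naturally_isomorphic (functor_comp F G) (functor_id D).

Section SemimoduleCategory.
Variable R : pzSemiRingType.

Lemma linear_ext (U V : lSemiModType R) (f g : {linear U -> V}) :
  f =1 g -> f = g.
Proof.
case: f g => [f [[fA] [fZ]]] [g [[gA] [gZ]]] /= /funext fg.
case: g / fg gA gZ => gA gZ.
by rewrite (Prop_irrelevance gA fA) (Prop_irrelevance gZ fZ).
Qed.

Definition semimod_id (U : lSemiModType R) : {linear U -> U} := idfun.
Definition semimod_comp (U V W : lSemiModType R)
    (g : {linear V -> W}) (f : {linear U -> V}) : {linear U -> W} := g \o f.

Fact semimod_compA (U V W X : lSemiModType R) (h : {linear W -> X})
    (g : {linear V -> W}) (f : {linear U -> V}) :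
  semimod_comp h (semimod_comp g f) = semimod_comp (semimod_comp h g) f.
Proof. exact: linear_ext. Qed.
Fact semimod_comp1m (U V : lSemiModType R) (f : {linear U -> V}) :
  semimod_comp (semimod_id V) f = f.
Proof. exact: linear_ext. Qed.
Fact semimod_compm1 (U V : lSemiModType R) (f : {linear U -> V}) :
  semimod_comp f (semimod_id U) = f.
Proof. exact: linear_ext. Qed.

Definition semimodules : category :=
  @Category (lSemiModType R) (fun U V => {linear U -> V}) semimod_id
    semimod_comp semimod_compA semimod_comp1m semimod_compm1.
End SemimoduleCategory.

Definition morita_equivalent (R S : pzSemiRingType) : Prop :=
  equivalent_categories (semimodules R) (semimodules S).

(* Main.v *)
Require Import Defs.
From HB Require Import structures.
From mathcomp Require Import all_boot all_order all_algebra.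
From mathcomp Require Import boolp.
Set Implicit Arguments.
Unset Strict Implicit.
Unset Printing Implicit Defensive.
Import Order.TTheory GRing.Theory.
Local Open Scope ring_scope.

(* The pivot is "R is nonzero and ideal-simple with an infinite element w".
   Ideal-simplicity writes 1 as a finite sum of terms a_i w b_i; since w is
   idempotent, this makes R additively idempotent and forces w r w = w for r <> 0,
   so w is a full idempotent whose corner w R w = {0, w} is the Boolean semiring.
   Hence R is Morita equivalent to B (via N |-> w N and L |-> Hom(w R, L)), and R
   acts on R w as the full endomorphism semiring of a join-retract of a finite
   power set, which is a finite distributive lattice.

   Conversely, an equivalence of categories sends the regular B-semimodule to a
   strong generator Q over R with End(Q) = {id, 0}.  Its trace ideal is R, so
   1 is a finite sum of values u_i(q_i), and each endomorphism x |-> u_i(x) q is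
   either id or 0: this yields both ideal-simplicity and an infinite element.

   In the endomorphism semiring of a finite distributive lattice, the step
   functions "0 below z, a elsewhere" sum up to the identity, and sandwiching an
   arbitrary endomorphism between them collapses ideals and congruences. *)

(** * Ideal-simple semirings with an infinite element *)

Section PrincipalIdeals.
Variable R : pzSemiRingType.

Definition principal_ideal (r x : R) : Prop :=
  exists s : seq (R * R), x = \sum_(p <- s) p.1 * r * p.2.

Lemma principal_ideal_is_ideal r : is_ideal (principal_ideal r).
Proof.
split.
- by exists [::]; rewrite big_nil.
- by move=> _ _ [s ->] [t ->]; exists (s ++ t); rewrite big_cat.
- move=> c _ [s ->]; exists [seq (c * p.1, p.2) | p <- s].
  by rewrite big_map mulr_sumr; apply: eq_bigr => p _ /=; rewrite !mulrA.
- move=> c _ [s ->]; exists [seq (p.1, p.2 * c) | p <- s].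
  by rewrite big_map mulr_suml; apply: eq_bigr => p _ /=; rewrite !mulrA.
Qed.

(** The ideal generated by [r] contains [r], so it is not zero; being all of [R], it contains 1. *)
Lemma ideal_simple_one (r : R) : ideal_simple R -> r != 0 ->
  exists s : seq (R * R), 1 = \sum_(p <- s) p.1 * r * p.2.
Proof.
move=> simR /eqP r0; have [I0|IT] := simR _ (principal_ideal_is_ideal r).
  have: principal_ideal r r by exists [:: (1, 1)]; rewrite big_seq1 mul1r mulr1.
  by rewrite I0.
have : classical_sets.setT (1 : R) by [].
by rewrite -IT.
Qed.

Lemma ideal_sum (I : R -> Prop) (T : Type) (s : seq T) (P : pred T) (F : T -> R) :
  is_ideal I -> (forall i, P i -> I (F i)) -> I (\sum_(i <- s | P i) F i).
Proof. by case=> I0 ID _ _ IF; apply: big_ind. Qed.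

End PrincipalIdeals.

Section IdealSimpleInfinite.
Variables (R : pzSemiRingType) (w : R).
Hypotheses (one_neq0 : (1 : R) <> 0) (simR : ideal_simple R).
Hypothesis (w_inf : is_infinite w).

Lemma inf_neq0 : w != 0.
Proof. by apply/eqP => w0; apply: one_neq0; rewrite -[1]addr0 -w0 w_inf. Qed.

(** In a decomposition of 1 into terms [a * w * b], doubling changes no term because [w + w = w];
    hence [1 + 1 = 1]. *)
Lemma addr_idem (x : R) : x + x = x.
Proof.
have [s Es] := ideal_simple_one simR inf_neq0.
suff E : 1 + 1 = 1 :> R by rewrite -[x]mul1r -mulrDl E.
rewrite Es -big_split; apply: eq_bigr => p _ /=.
by rewrite -mulrDl -mulrDr w_inf.
Qed.

Lemma addr_eq0l (x y : R) : x + y = 0 -> x = 0.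
Proof. by move=> E; rewrite -[x]addr0 -E addrA addr_idem. Qed.

Lemma addr_inf (x : R) : w + x = w.
Proof. by rewrite addrC w_inf. Qed.

(** Absorption gives [w = w * w + w * 1 = w * (w + 1) = w * w]. *)
Lemma inf_sq : w * w = w.
Proof.
rewrite -[RHS](w_inf (w * w)) -{5}[w]mulr1 -mulrDr.
by rewrite addr_inf.
Qed.

(** Since [w = w + w * a = w + b * w], expanding [w * r * w] shows that it absorbs every
    [w * (a * r * b) * w]. A decomposition of 1 into terms [a * r * b] makes it absorb
    [w * 1 * w = w], which itself absorbs everything. *)
Lemma inf_mul_inf (r : R) : r != 0 -> w * r * w = w.
Proof.
move=> /(ideal_simple_one simR) [s Es].
have absorb (a b : R) : w * r * w + w * (a * r * b) * w = w * r * w.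
  have E : w * r * w = (w + w * a) * r * (w + b * w) by rewrite !addr_inf.
  by rewrite {1}E [RHS]E !(mulrDl, mulrDr) -!addrA !mulrA addr_idem.
suff F : w * r * w = w * r * w + w * w by rewrite F inf_sq w_inf.
rewrite -[X in _ + X * _]mulr1 Es; elim: s {Es} => [|p s IH].
  by rewrite big_nil mulr0 mul0r addr0.
by rewrite big_cons mulrDr mulrDl addrA absorb.
Qed.

Lemma inf_factorization : exists (n : nat) (a b : 'I_n -> R),
  1 = \sum_(i < n) a i * w * b i.
Proof.
have [s Es] := ideal_simple_one simR inf_neq0.
exists (size s), (fun i => (tnth (in_tuple s) i).1), (fun i => (tnth (in_tuple s) i).2).
by rewrite {1}Es big_tnth.
Qed.

Lemma inf_corner (r : R) : w * r * w = 0 \/ w * r * w = w.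
Proof.
have [->|/inf_mul_inf] := eqVneq r 0; first by left; rewrite mulr0 mul0r.
by right.
Qed.

End IdealSimpleInfinite.

(** * Representation on a finite distributive lattice *)

(** An idempotent join endomorphism of a power set; its fixed points will form the lattice of the
    representation. *)
Record set_retraction (T : finType) := SetRetraction {
  retr :> {set T} -> {set T};
  retr0 : retr set0 = set0;
  retrU : {morph retr : A B / A :|: B};
  retr_idem : forall A, retr (retr A) = retr A
}.

Section FixedPoints.
Variables (T : finType) (phi : set_retraction T).

Record fixed_set := FixedSet { fixval :> {set T}; fixvalP : phi fixval == fixval }.
HB.instance Definition _ := [isSub for fixval].
HB.instance Definition _ := [Finite of fixed_set by <:].

Implicit Types A B C : fixed_set.

Lemma fixedE A : phi A = A.
Proof. exact/eqP/fixvalP. Qed.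

Lemma retrS : {homo phi : X Y / X \subset Y}.
Proof. by move=> X Y /setUidPr <-; rewrite retrU subsetUl. Qed.

Definition fix_le : rel fixed_set := fun A B => A \subset B.
Definition to_fix (X : {set T}) : fixed_set := FixedSet (introT eqP (retr_idem phi X)).

Fact fix_le_refl : reflexive fix_le. Proof. by move=> A; apply: subxx. Qed.
Fact fix_le_anti : antisymmetric fix_le.
Proof. by move=> A B; rewrite -eqEsubset => /eqP/val_inj. Qed.
Fact fix_le_trans : transitive fix_le.
Proof. by move=> A B C; apply: subset_trans. Qed.

HB.instance Definition _ := Order.Le_isPOrder.Build Order.SetSubsetOrder.subset_display fixed_set
  fix_le_refl fix_le_anti fix_le_trans.

(** The meet is [phi (B :&: C)]: by monotonicity it lies inside [phi B = B] and [phi C = C], and a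
    fixed [A] inside [B :&: C] satisfies [A = phi A], so it lies inside [phi (B :&: C)]. *)
Fact fixI_le A B C : (A <= to_fix (B :&: C))%O = (A <= B)%O && (A <= C)%O.
Proof.
rewrite -[LHS]/(fixval A \subset phi (B :&: C)) -subsetI.
apply/idP/idP => [sA|/retrS]; last by rewrite fixedE.
rewrite subsetI; apply/andP; split; apply: (subset_trans sA).
  by have := retrS (subsetIl B C); rewrite fixedE.
by have := retrS (subsetIr B C); rewrite fixedE.
Qed.

Fact fixU_le A B C : (to_fix (A :|: B) <= C)%O = (A <= C)%O && (B <= C)%O.
Proof.
by rewrite -[LHS]/(phi (A :|: B) \subset C) retrU !fixedE subUset.
Qed.

HB.instance Definition _ := Order.POrder_MeetJoin_isLattice.Build
  Order.SetSubsetOrder.subset_display fixed_set fixI_le fixU_le.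

Fact fixvalU A B : fixval (A `|` B)%O = A :|: B.
Proof. by rewrite /= retrU !fixedE. Qed.

(* phi sends a union decomposition of an element back to one of itself. *)
Fact fix_meetUl : left_distributive (@Order.meet _ fixed_set) (@Order.join _ fixed_set).
Proof.
move=> A B C; apply/le_anti/andP; split; last first.
  by rewrite leUx !leI2 ?leUl ?leUr.
set X := (X in (X <= _)%O); rewrite -[(X <= _)%O]/(_ \subset _) fixvalU.
have sXC : (X <= C)%O by rewrite leIr.
have sXU : (X <= A `|` B)%O by rewrite leIl.
have -> : fixval X = phi (X :&: A) :|: phi (X :&: B).
  rewrite -retrU -setIUr -fixvalU (_ : fixval X :&: _ = X) ?fixedE //.
  exact/setIidPl.
have sub (D : fixed_set) : phi (X :&: D) \subset fixval (D `&` C)%O.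
  suff : (X `&` D <= D `&` C)%O by [].
  by rewrite lexI leIr (le_trans _ sXC) ?leIl.
exact: setUSS.
Qed.

HB.instance Definition _ := Order.Lattice_Meet_isDistrLattice.Build
  Order.SetSubsetOrder.subset_display fixed_set fix_meetUl.

Definition fix_bot : fixed_set := FixedSet (introT eqP (retr0 phi)).
Fact fix_bot_le A : (fix_bot <= A)%O. Proof. exact: sub0set. Qed.
HB.instance Definition _ :=
  Order.hasBottom.Build Order.SetSubsetOrder.subset_display fixed_set fix_bot_le.

Fact fix_le_top A : (A <= to_fix setT)%O.
Proof. by have := retrS (subsetT A); rewrite fixedE. Qed.
HB.instance Definition _ :=
  Order.hasTop.Build Order.SetSubsetOrder.subset_display fixed_set fix_le_top.

End FixedPoints.

Section Representation.
Variables (R : pzSemiRingType) (w : R).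
Hypotheses (one_neq0 : (1 : R) <> 0) (simR : ideal_simple R).
Hypothesis (w_inf : is_infinite w).
Variables (n : nat) (a b : 'I_n -> R).
Hypothesis one_sum : 1 = \sum_(i < n) a i * w * b i.

Let idemR := addr_idem one_neq0 simR w_inf.

(** The left ideal [R w] is a retract of the power set: [vec] joins the generators [a i * w],
    [coords] records which entries [w * (b i * x) * w] of the corner {0, [w]} are nonzero, and [vec]
    undoes [coords] on [R w]. *)
Definition vec (A : {set 'I_n}) : R := \sum_(i in A) a i * w.
Definition coords (x : R) : {set 'I_n} := [set i | w * (b i * x) * w != 0].

Lemma vec0 : vec finset.set0 = 0.
Proof. by rewrite /vec big_set0. Qed.

Lemma vecU A B : vec (A :|: B) = vec A + vec B.
Proof.
rewrite /vec !(big_mkcond (fun i => i \in _)) -big_split.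
by apply: eq_bigr => i _; rewrite inE; do 2![case: (i \in _)];
  rewrite /= ?idemR ?addr0 ?add0r.
Qed.

Lemma vec_inf A : vec A * w = vec A.
Proof.
rewrite /vec mulr_suml; apply: eq_bigr => i _.
by rewrite -mulrA (inf_sq w_inf).
Qed.

Lemma coords0 : coords 0 = finset.set0.
Proof. by apply/setP => i; rewrite !inE mulr0 mulr0 mul0r eqxx. Qed.

(** Addition is idempotent, so a sum with a nonzero term is nonzero, and supports are united. *)
Lemma coordsD x y : coords (x + y) = coords x :|: coords y.
Proof.
apply/setP => i; rewrite !inE mulrDr mulrDr mulrDl.
set p := w * _ * w; set q := w * _ * w.
have [->|p0] /= := eqVneq p 0; first by rewrite add0r.
by apply/eqP => /(addr_eq0l one_neq0 simR w_inf)/eqP; apply/negP.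
Qed.

Lemma coords_inf x : coords (x * w) = coords x.
Proof. by apply/setP => i; rewrite !inE mulrA -!mulrA (inf_sq w_inf). Qed.

(** Multiplying the decomposition of 1 by [x * w] gives terms [a i * (w * (b i * x) * w)], whose
    last factor is 0 or [w]; the index set where it is [w] is [coords x]. *)
Lemma vec_coords x : vec (coords x) = x * w.
Proof.
rewrite -[x in RHS]mul1r one_sum !mulr_suml /vec big_mkcond.
apply: eq_bigr => i _; rewrite inE.
have -> : a i * w * b i * x * w = a i * (w * (b i * x) * w) by rewrite !mulrA.
have [->|E] := inf_corner one_neq0 simR w_inf (b i * x).
  by rewrite eqxx mulr0.
by case: eqP => [->|_]; rewrite ?E ?mulr0.
Qed.

Fact coords_vec0 : coords (vec finset.set0) = finset.set0.
Proof. by rewrite vec0 coords0. Qed.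
Fact coords_vecU : {morph coords \o vec : A B / A :|: B}.
Proof. by move=> A B; rewrite /= vecU coordsD. Qed.
Fact coords_vec_idem A : coords (vec (coords (vec A))) = coords (vec A).
Proof. by rewrite vec_coords coords_inf. Qed.

Definition coord_retraction : set_retraction 'I_n :=
  @SetRetraction _ (coords \o vec) coords_vec0 coords_vecU coords_vec_idem.

Local Notation M := (fixed_set coord_retraction).

Lemma fixed_coords (x : R) : fixval (to_fix coord_retraction (coords x)) = coords x.
Proof. by rewrite /= vec_coords coords_inf. Qed.

Lemma coords_fixed (A : M) : coords (vec A) = A.
Proof. exact: (fixedE A). Qed.

(** Left multiplication by [r] on [R w], read through the bijection [vec] between fixed sets and
    [R w]. *)
Definition act (r : R) (A : M) : M := to_fix coord_retraction (coords (r * vec A)).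

Fact act_bot r : act r \bot%O = \bot%O.
Proof. by apply: val_inj; rewrite [LHS]fixed_coords vec0 mulr0 coords0. Qed.

Fact actU r (A B : M) : act r (A `|` B)%O = (act r A `|` act r B)%O.
Proof.
apply: val_inj; rewrite [RHS]fixvalU [LHS]fixed_coords !fixed_coords.
by rewrite fixvalU vecU mulrDr coordsD.
Qed.

Lemma vec_act r (A : M) : vec (act r A) = r * vec A.
Proof. by rewrite fixed_coords vec_coords -mulrA vec_inf. Qed.

Definition act_endo (r : R) : join_endo M := JoinEndo (act_bot r) (actU r).

Fact act_endo_nmod : nmod_morphism act_endo.
Proof.
split=> [|r s]; apply: join_endo_ext => A; apply: val_inj.
  by rewrite [LHS]fixed_coords mul0r coords0.
by rewrite [RHS]fixvalU [LHS]fixed_coords !fixed_coords mulrDl coordsD.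
Qed.

Fact act_endo_monoid : monoid_morphism act_endo.
Proof.
split=> [|r s]; apply: join_endo_ext => A; apply: val_inj.
  by rewrite [LHS]fixed_coords mul1r coords_fixed.
rewrite [LHS]fixed_coords [RHS]fixed_coords fixed_coords vec_coords.
by rewrite -[s * _ * w]mulrA vec_inf mulrA.
Qed.

HB.instance Definition _ := GRing.isNmodMorphism.Build R (join_endo M) act_endo act_endo_nmod.
HB.instance Definition _ := GRing.isMonoidMorphism.Build R (join_endo M) act_endo act_endo_monoid.

(** The only possible preimage of [f]: if [f] is multiplication by [r], then [r] is the sum of the
    [r * a i * w * b i], and [r * a i * w] is the value of [f] at the generator [a i * w]. *)
Definition endo_coeff (f : join_endo M) : R :=
  \sum_(i < n) vec (f (to_fix coord_retraction (coords (a i)))) * b i.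

Lemma act_endoK : cancel act_endo endo_coeff.
Proof.
move=> r; rewrite /endo_coeff -[RHS]mulr1 one_sum mulr_sumr.
apply: eq_bigr => i _; rewrite -[act_endo r _]/(act r _).
by rewrite vec_act fixed_coords vec_coords !mulrA.
Qed.

Lemma vec_inj : injective (fun A : M => vec A).
Proof.
by move=> A B E; apply: val_inj; rewrite /= -coords_fixed E coords_fixed.
Qed.

Lemma vec_join (I : finType) (P : pred I) (F : I -> M) :
  vec (\join_(i | P i) F i)%O = \sum_(i | P i) vec (F i).
Proof.
apply: (big_morph (fun A : M => vec A)); last exact: vec0.
by move=> A B; rewrite fixvalU vecU.
Qed.

(** Each [A] is the join of the generators with index in [A], so [f A] is the join of their images;
    the corner entries of [vec A] select the same indices. *)
Lemma endo_coeffK : cancel endo_coeff act_endo.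
Proof.
move=> f; apply: join_endo_ext => A; apply: vec_inj.
have -> : f A = (\join_(i in fixval A) f (to_fix coord_retraction (coords (a i))))%O.
  rewrite -(big_morph f (@join_endoU _ _ f) (@join_endo0 _ _ f)); congr (f _).
  apply: vec_inj; rewrite vec_join; apply: eq_bigr => i _.
  by rewrite fixed_coords vec_coords.
rewrite vec_join -[act_endo _ _]/(act _ _) vec_act.
rewrite /endo_coeff mulr_suml [RHS]big_mkcond; apply: eq_bigr => i _.
rewrite -{2}(coords_fixed A) inE.
set v := vec (f _).
(* Both [v] and [vec A] are fixed by right multiplication by [w], so [b i * vec A] may be replaced
   by its corner entry. *)
have -> : v * b i * vec A = v * (w * (b i * vec A) * w).
  by rewrite !mulrA vec_inf -[_ * vec A * w]mulrA vec_inf.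
have [->|E] := inf_corner one_neq0 simR w_inf (b i * vec A).
  by rewrite eqxx mulr0.
by case: eqP => [->|_]; rewrite ?E ?mulr0 // vec_inf.
Qed.

Lemma fixed_nonzero : exists A : M, A != \bot%O.
Proof.
exists (to_fix coord_retraction (coords 1)); apply/eqP => E.
apply: one_neq0; rewrite -[1]addr0.
have /= := congr1 (fun A : M => vec A) E.
rewrite !vec_coords vec0 mul1r (inf_sq w_inf) => w0.
by rewrite -w0 w_inf.
Qed.

End Representation.

Lemma ideal_simple_infinite_endo (R : pzSemiRingType) (w : R) :
  (1 : R) <> 0 -> ideal_simple R -> is_infinite w ->
  exists (d : Order.disp_t) (M : finTBDistrLatticeType d),
    (exists x : M, x != \bot%O) /\ semiring_iso R (join_endo M).
Proof.
move=> one_neq0 simR w_inf.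
have [n [a [b E]]] := inf_factorization one_neq0 simR w_inf.
exists _, (fixed_set (coord_retraction one_neq0 simR w_inf E)).
split; first exact: fixed_nonzero.
exists (act_endo one_neq0 simR w_inf E).
by exists (@endo_coeff _ _ one_neq0 simR w_inf _ _ _ E); [exact: act_endoK | exact: endo_coeffK].
Qed.

(** * Endomorphism semirings of finite distributive lattices *)

Section Transport.
Variables (R S : pzSemiRingType) (f : {rmorphism R -> S}) (g : S -> R).
Hypotheses (fK : cancel f g) (gK : cancel g f).

Let f_inj : injective f := can_inj fK.

Lemma ideal_simple_iso : ideal_simple S -> ideal_simple R.
Proof.
move=> simS I [I0 ID IMl IMr].
have idJ : is_ideal (fun y => I (g y)).
  split.
  - by rewrite -(rmorph0 f) fK.
  - by move=> x y Ix Iy; rewrite -[x]gK -[y]gK -rmorphD fK; apply: ID.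
  - by move=> r x Ix; rewrite -[x]gK -[r]gK -rmorphM fK; apply: IMl.
  - by move=> r x Ix; rewrite -[x]gK -[r]gK -rmorphM fK; apply: IMr.
have IE x : I x = I (g (f x)) by rewrite fK.
have [J0|JT] := simS _ idJ.
  left; apply/funext => x; rewrite IE -[I (g _)]/((fun y => I (g y)) (f x)) J0.
  apply/propext; split => [fx0|->]; last by rewrite /= rmorph0.
  by apply: f_inj; rewrite rmorph0.
right; apply/funext => x; rewrite IE -[I (g _)]/((fun y => I (g y)) (f x)) JT.
by [].
Qed.

Lemma congruence_simple_iso : congruence_simple S -> congruence_simple R.
Proof.
move=> simS rho [rr rs rt rD rM].
have cong : is_congruence (fun x y => rho (g x) (g y)).
  split.
  - by move=> x; apply: rr.
  - by move=> x y; apply: rs.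
  - by move=> x y z; apply: rt.
  - move=> x x' y y' xx' yy'.
    by rewrite -[x]gK -[x']gK -[y]gK -[y']gK -!rmorphD !fK; apply: rD.
  - move=> x x' y y' xx' yy'.
    by rewrite -[x]gK -[x']gK -[y]gK -[y']gK -!rmorphM !fK; apply: rM.
have [E|E] := simS _ cong; [left|right] => x y; last by have := E (f x) (f y); rewrite !fK.
by have [] := E (f x) (f y); rewrite !fK => h h'; split => [/h/f_inj|->].
Qed.

Lemma complete_iso : complete_semiring S -> complete_semiring R.
Proof.
case=> sum sumP; exists (fun Omega m => g (sum Omega (fun i => f (m i)))).
split.
- by move=> m; rewrite (sum_empty sumP) -(rmorph0 f) fK.
- by move=> m; rewrite (sum_single sumP) fK.
- by move=> m; rewrite (sum_pair sumP) -rmorphD fK.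
- move=> Omega Lambda P m partP; rewrite (sum_partition sumP _ partP).
  by congr g; congr (sum _); apply/funext => j; rewrite gK.
- move=> Omega r m; apply: f_inj; rewrite rmorphM !gK (sum_distrr sumP).
  by congr (sum _); apply/funext => j; rewrite rmorphM.
- move=> Omega r m; apply: f_inj; rewrite rmorphM !gK (sum_distrl sumP).
  by congr (sum _); apply/funext => j; rewrite rmorphM.
Qed.

Lemma simple_iso : simple_semiring S -> simple_semiring R.
Proof.
case=> one_neq0 simI simC; split; last exact: congruence_simple_iso.
  by move=> E; apply: one_neq0; rewrite -(rmorph1 f) E rmorph0.
exact: ideal_simple_iso.
Qed.

End Transport.

(** * Completeness: joins of arbitrary families of endomorphisms *)

Section FamilyJoins.
Context {d : Order.disp_t} (M : finTBDistrLatticeType d).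

(** A finite join over the values attained, so that the index type may be infinite. *)
Definition fjoin (I : Type) (F : I -> M) : M :=
  (\join_(y : M | `[< exists i, F i = y >]) y)%O.

Lemma fjoin_le (I : Type) (F : I -> M) (z : M) :
  (fjoin F <= z)%O <-> forall i, (F i <= z)%O.
Proof.
split=> [h i|h].
  by apply: le_trans h; apply: joins_sup; apply/asboolP; exists i.
by apply/joinsP => y /asboolP [i <-].
Qed.

(** Reduces each summation law below to a comparison of upper bounds. *)
Lemma fjoin_eq (I : Type) (F : I -> M) (x : M) :
  (forall z : M, (x <= z)%O <-> forall i, (F i <= z)%O) -> fjoin F = x.
Proof.
move=> h; apply/le_anti/andP; split; first by apply/fjoin_le/h.
by apply/h/fjoin_le.
Qed.

Lemma fjoin_endo (I : Type) (f : join_endo M) (F : I -> M) :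
  f (fjoin F) = fjoin (fun i => f (F i)).
Proof.
apply/esym/fjoin_eq => z.
rewrite /fjoin (big_morph f (@join_endoU _ _ f) (@join_endo0 _ _ f)).
split=> [h i|h].
  by apply: le_trans h; apply: (@joins_sup _ _ _ (F i) _ f); apply/asboolP; exists i.
by apply/joinsP => y /asboolP [i <-].
Qed.

Section EndoSum.
Variables (I : Type) (m : I -> join_endo M).

Fact endo_sum0 : fjoin (fun i => m i \bot%O) = \bot%O.
Proof.
apply: fjoin_eq => z; split=> [_ i|_]; last exact: le0x.
by rewrite join_endo0 le0x.
Qed.

Fact endo_sumU (x y : M) : fjoin (fun i => m i (x `|` y)%O) =
  (fjoin (fun i => m i x) `|` fjoin (fun i => m i y))%O.
Proof.
apply: fjoin_eq => z; rewrite leUx; split=> [/andP[/fjoin_le hx /fjoin_le hy] i|h].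
  by rewrite join_endoU leUx hx hy.
apply/andP; split; apply/fjoin_le => i; have := h i;
  by rewrite join_endoU leUx => /andP[].
Qed.

Definition endo_sum : join_endo M := JoinEndo endo_sum0 endo_sumU.
End EndoSum.

Lemma endo_complete : complete_semiring (join_endo M).
Proof.
exists endo_sum; split.
- move=> m; apply: join_endo_ext => x; apply: fjoin_eq => z.
  by split=> [_ []|_]; apply: le0x.
- move=> m; apply: join_endo_ext => x; apply: fjoin_eq => z.
  by split=> [h []|].
- move=> m; apply: join_endo_ext => x; apply: fjoin_eq => z.
  rewrite leUx; split=> [/andP[h h'] []//|h].
  by rewrite !h.
- move=> Omega Lambda P m [_ _ cover]; apply: join_endo_ext => x.
  apply: fjoin_eq => z; split=> [/fjoin_le h i|h].
    have : classical_sets.setT i by [].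
    rewrite -cover => -[j _ Pji].
    exact: ((fjoin_le _ _).1 (h j) (exist _ i (classical_sets.mem_set Pji))).
  by apply/fjoin_le => j; apply/fjoin_le => i; apply: h.
- by move=> Omega r m; apply: join_endo_ext => x; apply: fjoin_endo.
- by move=> Omega r m; apply: join_endo_ext.
Qed.

End FamilyJoins.

(** * Step functions and simplicity *)

Section StepEndomorphisms.
Context {d : Order.disp_t} (M : finTBDistrLatticeType d).

Definition step_fun (a z t : M) : M := if (t <= z)%O then \bot%O else a.

Fact step0 a z : step_fun a z \bot%O = \bot%O.
Proof. by rewrite /step_fun le0x. Qed.

Fact stepU a z : {morph step_fun a z : x y / (x `|` y)%O}.
Proof.
move=> x y; rewrite /step_fun leUx.
by do 2![case: (_ <= z)%O]; rewrite /= ?joinx0 ?join0x ?joinxx.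
Qed.

Definition step (a z : M) : join_endo M := JoinEndo (step0 a z) (stepU a z).

Lemma endo_sumE (I : Type) (s : seq I) (P : pred I) (F : I -> join_endo M) (x : M) :
  (\sum_(i <- s | P i) F i) x = (\join_(i <- s | P i) F i x)%O.
Proof. by apply: (big_morph (fun f : join_endo M => f x)). Qed.

(* Sandwiching f between step functions isolates the truth value of f x <= z. *)
Lemma step_mul (f : join_endo M) (a z x z' : M) :
  step a z * f * step x z' = if (f x <= z)%O then 0 else step a z'.
Proof.
apply: join_endo_ext => t.
rewrite -[LHS]/(step_fun a z (f (step_fun x z' t))) {2}/step_fun.
case: ifP => [tz'|tz']; last by rewrite /step_fun; case: ifP => //= _; rewrite /step_fun tz'.
rewrite join_endo0 step0; case: ifP => //= _.
by rewrite /step_fun tz'.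
Qed.

(** At [t], let [w] be the join of the values of all steps below the identity. If [t] were not below
    [w], a minimal [a] below [t] and not below [w] would be join-prime and would yield one more such
    step, with value [a] at [t]. *)
Lemma one_steps : (1 : join_endo M) =
  \sum_(p : M * M | [forall t, step p.1 p.2 t <= t]%O) step p.1 p.2.
Proof.
apply: join_endo_ext => t; rewrite endo_sumE -[LHS]/t.
apply/le_anti/andP; split; last by apply/joinsP => p /forallP.
set w := (X in (_ <= X)%O); apply: contraT => tw.
pose P a := (a <= t)%O && ~~ (a <= w)%O.
have Pt : P t by rewrite /P lexx.
(* Minimality is measured by the number of elements below [a]. *)
have [a /andP[at_ aw] amin] := @arg_minnP M t P (fun a => #|[set b | (b <= a)%O]|) Pt.
have below b : (b < a)%O -> (b <= w)%O.
  move=> ba; apply: contraT => bw.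
  have := amin b; rewrite /P bw (le_trans (ltW ba) at_) => /(_ isT).
  rewrite leqNgt => /negP[]; apply: proper_card; apply/properP; split.
    by apply/subsetP => c; rewrite !inE => /le_trans; apply; exact: ltW.
  by exists a; rewrite !inE ?lexx ?(lt_geF ba).
pose z := (\join_(s | ~~ (a <= s)) s)%O.
(* Here distributivity enters: if [a] were below [z], it would be the join of its meets with the [s]
   not above [a]. These meets are strictly below [a], hence below [w], and so would be [a]. *)
have az : ~~ (a <= z)%O.
  apply: contra aw => az; rewrite -(meet_idPl az) /z.
  rewrite (big_morph (fun s => a `&` s)%O (meetUr a) (meetx0 a)).
  apply/joinsP => s sa; apply: below.
  by rewrite lt_neqAle leIl andbT; apply: contra sa => /eqP <-; rewrite leIr.
have zP s : ~~ (s <= z)%O -> (a <= s)%O.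
  by apply: contraR => sa; apply: (@joins_sup _ _ _ s _ id).
(* Now [z] is the largest element not above [a], so [step a z] is below the identity; its value at
   [t] is [a], since [t] is above [a] and so not below [z]. *)
suff : (step a z t <= w)%O.
  have tz : (t <= z)%O = false.
    by apply: contraNF az; apply: le_trans.
  by rewrite /= /step_fun tz (negPf aw).
apply: (@joins_sup _ _ _ (a, z) _ (fun p => step p.1 p.2 t)).
apply/forallP => s; rewrite /= /step_fun; case: ifP => [_|/negbT/zP//].
exact: le0x.
Qed.

Lemma endo_neq0 (f : join_endo M) : f <> 0 -> exists x, ~~ (f x <= \bot)%O.
Proof.
move=> f0; apply: contrapT => nex; apply: f0; apply: join_endo_ext => x.
rewrite -[RHS]/(\bot%O : M); apply/eqP; rewrite -lex0; apply: contraT => fx.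
by case: nex; exists x.
Qed.

(** A nonzero value [f x] lets the sandwich of [f] between [step a \bot] and [step x z] produce
    every [step a z], and steps sum to 1. *)
Lemma endo_ideal_simple : ideal_simple (join_endo M).
Proof.
move=> I idI; have [I0 _ IMl IMr] := idI.
have [[f If f0]|none] := pselect (exists2 f, I f & f <> 0); last first.
  left; apply/funext => f; apply/propext; split=> [If|->//].
  by apply: contrapT => f0; apply: none; exists f.
right; apply/funext => g; apply/propext; split=> // _.
have [x fx] := endo_neq0 f0.
suff I1 : I 1 by rewrite -[g]mulr1; apply: IMl.
rewrite one_steps; apply: ideal_sum => // -[a z] _ /=.
have <- : step a \bot%O * f * step x z = step a z by rewrite step_mul (negPf fx).
exact/IMr/IMl.
Qed.

Lemma endo_congruence_simple : congruence_simple (join_endo M).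
Proof.
move=> rho [rr rs rt rD rM].
have [[f [g [fg nle]]]|none] :=
    pselect (exists f g, rho f g /\ exists x, ~~ (f x <= g x)%O); last first.
  left => f g; split=> [fg|->//]; apply: join_endo_ext => x.
  apply/le_anti/andP; split; apply: contraT => nle; case: none.
    by exists f, g; split=> //; exists x.
  by exists g, f; split; [exact: rs | exists x].
right; have {nle} [x nle] := nle.
(* Where [f x] is not below [g x], sandwiching with threshold [g x] turns [f] into [step \top \bot]
   and [g] into 0. *)
have top0 : rho (step \top%O \bot%O) 0.
  have := rM _ _ _ _ (rM _ _ _ _ (rr (step \top%O (g x))) fg) (rr (step x \bot%O)).
  by rewrite !step_mul (negPf nle) lexx.
(* The greatest endomorphism [step \top \bot] absorbs every [h]; since it is congruent to 0, so is
   [h]. *)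
have all0 h : rho h 0.
  have : rho (h + step \top%O \bot%O) (h + 0) by apply: rD.
  have -> : h + step \top%O \bot%O = step \top%O \bot%O.
    apply: join_endo_ext => t; rewrite -[LHS]/(h t `|` step_fun \top \bot t)%O.
    rewrite /= /step_fun lex0; case: eqP => [->|_]; last by rewrite joinx1.
    by rewrite join_endo0 joinxx.
  by rewrite addr0 => /rs/rt; apply.
by move=> h k; apply: rt (all0 h) (rs _ _ (all0 k)).
Qed.

Lemma endo_simple : (exists x : M, x != \bot%O) -> simple_semiring (join_endo M).
Proof.
case=> x x0; split; [|exact: endo_ideal_simple|exact: endo_congruence_simple].
by move=> /(congr1 (fun f : join_endo M => f x)) /= /eqP; apply/negP.
Qed.

End StepEndomorphisms.

(** * An infinite element in every complete semiring *)

Section CompleteInfinite.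
Variables (R : pzSemiRingType) (sum : forall Omega : Type, (Omega -> R) -> R).
Hypothesis sumP : is_summation sum.

(** Only sums over [unit] are evaluated by an axiom. Taking [unit] as a single block, indexed first
    by [unit] and then by [T], evaluates the sum over the block and then the sum over [T]. *)
Lemma sum_const_singleton (T : Type) (t : T) (c : R) :
  (forall x : T, x = t) -> sum (fun _ : T => c) = c.
Proof.
move=> tP.
have part (L : Type) (l : L) : (forall x, x = l) ->
    @is_partition unit L (fun _ => classical_sets.setT).
  move=> lP; split; first by move=> _; exists tt.
    by move=> i j _ _ _; rewrite (lP i) (lP j).
  by apply/funext => u; apply/propext; split=> // _; exists l.
have Eu := sum_partition sumP (fun _ => c) (part unit tt (fun x => let: tt := x in erefl)).
rewrite !(sum_single sumP) in Eu.
have := sum_partition sumP (fun _ => c) (part T t tP).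
by rewrite (sum_single sumP) -Eu.
Qed.

(** Partition [U] into the singletons of the [h t], indexed by [T]. *)
Lemma sum_reindex (T U : Type) (h : T -> U) (m : U -> R) :
  bijective h -> sum m = sum (fun t => m (h t)).
Proof.
move=> [k hK kK].
have part : is_partition (fun t => classical_sets.set1 (h t)).
  split; first by move=> t; exists (h t).
    by move=> i j _ _ [x [-> E]]; rewrite -[i]hK E hK.
  by apply/funext => u; apply/propext; split=> // _; exists (k u); [|exact/esym/kK].
rewrite (sum_partition sumP m part); congr (sum _); apply/funext => t.
have tP (x : classical_sets.set_type (classical_sets.set1 (h t))) :
    x = exist _ (h t) (classical_sets.mem_set (erefl (h t))).
  by apply: val_inj; case: x => x /= /classical_sets.set_mem.
rewrite -[RHS](sum_const_singleton (m (h t)) tP).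
congr (sum _); apply/funext => x; congr m.
by rewrite (tP x).
Qed.

(* Hilbert's hotel: shifting the copies of r leaves room for one more. *)
Lemma complete_infinite : is_infinite (sum (fun p : R * nat => p.1)).
Proof.
move=> r; set w := sum _.
pose P (c : bool) : classical_sets.set (R * nat) := fun p => (p != (r, 0%N)) = c.
have partP : is_partition P.
  split.
  - by case; [exists (r, 1%N) | exists (r, 0%N)]; rewrite /P /= ?eqxx // xpair_eqE andbF.
  - by move=> c c' _ _ [p [<- <-]].
  - by apply/funext => p; apply/propext; split=> // _; exists (p != (r, 0%N)).
rewrite {2}/w (sum_partition sumP _ partP) (sum_pair sumP); congr (_ + _).
  have f0 : P false (r, 0%N) by rewrite /P eqxx.
  have uniq_f (x : classical_sets.set_type (P false)) :
      x = exist _ (r, 0%N) (classical_sets.mem_set f0).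
    by apply: val_inj; case: x => x /= /classical_sets.set_mem /negbFE/eqP.
  rewrite -[LHS](sum_const_singleton r uniq_f).
  by congr (sum _); apply/funext => x; rewrite (uniq_f x).
have shiftP p : P true (p.1, (p.2 + (p.1 == r))%N).
  by rewrite /P xpair_eqE /=; case: eqP => //=; rewrite addn1.
pose h p : classical_sets.set_type (P true) :=
  exist _ (p.1, (p.2 + (p.1 == r))%N) (classical_sets.mem_set (shiftP p)).
rewrite (@sum_reindex _ _ h); first by congr (sum _).
exists (fun x => ((val x).1, ((val x).2 - ((val x).1 == r))%N)).
  by move=> [s n] /=; rewrite addnK.
move=> [[s n] /= xP]; apply: val_inj => /=; congr (_, _); apply: subnK.
move/classical_sets.set_mem: xP; rewrite /P xpair_eqE.
by case: eqP => //= _; rewrite lt0n.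
Qed.

End CompleteInfinite.

(** * Morita equivalence with the Boolean semiring *)

Section LinearInverse.
Variables (R : pzSemiRingType) (U V : lSemiModType R).
Variables (f : {linear U -> V}) (g : V -> U).
Hypotheses (fK : cancel f g) (gK : cancel g f).

Fact linear_inverse_semilinear : semilinear_for *:%R g.
Proof.
split=> [r x|x y]; apply: (can_inj fK); first by rewrite linearZ !gK.
by rewrite linearD !gK.
Qed.

Definition linear_inverse : {linear V -> U} :=
  HB.pack g (GRing.isSemilinear.Build R V U *:%R g linear_inverse_semilinear).

Lemma bijective_is_isom : @is_isom (semimodules R) U V f.
Proof. by exists linear_inverse; split; apply: linear_ext. Qed.

End LinearInverse.

Section BooleanSemimodules.

Lemma boolean_scale (V : lSemiModType boolean) (c : boolean) (x : V) :
  c *: x = if c then x else 0.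
Proof. by case: c; [apply: scale1r | apply: scale0r]. Qed.

Lemma boolean_idem (V : lSemiModType boolean) (x : V) : x + x = x.
Proof.
have E : (1 + 1 : boolean) = 1 by [].
by rewrite -[x]scale1r -scalerDl E.
Qed.

Section AdditiveMaps.
Variables (U V : lSemiModType boolean) (f : U -> V).
Hypotheses (f0 : f 0 = 0) (fD : {morph f : x y / x + y}).

Fact boolean_semilinear : semilinear_for *:%R f.
Proof. by split=> // c x; rewrite !boolean_scale; case: c. Qed.

Definition boolean_linear : {linear U -> V} :=
  HB.pack f (GRing.isSemilinear.Build boolean U V *:%R f boolean_semilinear).
End AdditiveMaps.

Variables (V : nmodType) (idem : forall x : V, x + x = x).

(** The type carries the proof of idempotence, because [1 + 1 = 1] in the scalars forces it and the
    semimodule instance needs it for additivity in the scalar. *)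
Definition boolean_semimod of (forall x : V, x + x = x) : Type := V.
Local Notation W := (boolean_semimod idem).
HB.instance Definition _ := GRing.Nmodule.on W.

Definition cond_scale (c : boolean) (x : W) : W := if c then x else 0.

Fact cond_scaleA (c c' : boolean) (x : W) :
  cond_scale c (cond_scale c' x) = cond_scale (c * c') x.
Proof. by case: c; case: c'. Qed.
Fact cond_scale0 (x : W) : cond_scale 0 x = 0. Proof. by []. Qed.
Fact cond_scale1 : left_id 1 cond_scale. Proof. by []. Qed.
Fact cond_scaleDr : right_distributive cond_scale +%R.
Proof. by case=> x y //=; rewrite addr0. Qed.
Fact cond_scaleDl (x : W) : {morph cond_scale^~ x : c c' / c + c'}.
Proof.
case; case; rewrite /cond_scale /= ?addr0 ?add0r //.
Qed.
HB.instance Definition _ := GRing.Nmodule_isLSemiModule.Build boolean W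
  cond_scaleA cond_scale0 cond_scale1 cond_scaleDr cond_scaleDl.
End BooleanSemimodules.

(** * The corner functor and coinduction as inverse equivalences *)

Section Morita.
Variables (R : pzSemiRingType) (w : R).
Hypotheses (one_neq0 : (1 : R) <> 0) (simR : ideal_simple R).
Hypothesis (w_inf : is_infinite w).
Variables (n : nat) (a b : 'I_n -> R).
Hypothesis one_sum : 1 = \sum_(i < n) a i * w * b i.

Let idemR := addr_idem one_neq0 simR w_inf.
Let wP := inf_corner one_neq0 simR w_inf.
Let ww := inf_sq w_inf.

Section Corner.
Variable N : lSemiModType R.

(** As [w] is idempotent, [w N] is the set of vectors fixed by [w]. *)
Definition corner_pred : pred N := fun x => w *: x == x.
Fact corner_addr_closed : addr_closed corner_pred.
Proof.
split=> [|x y]; rewrite !unfold_in ?scaler0 //.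
by move=> /eqP Ex /eqP Ey; rewrite scalerDr Ex Ey.
Qed.

Record corner := Corner { cval :> N; cvalP : corner_pred cval }.
HB.instance Definition _ := [isSub for cval].
HB.instance Definition _ := [Choice of corner by <:].
HB.instance Definition _ := GRing.SubChoice_isSubNmodule.Build N corner_pred corner corner_addr_closed.

Lemma cornerE (x : corner) : w *: cval x = cval x.
Proof. exact/eqP/cvalP. Qed.

Fact corner_idem (x : corner) : x + x = x.
Proof.
by apply: val_inj; rewrite raddfD /= -[cval x]scale1r -scalerDl idemR.
Qed.

Definition corner_mod : lSemiModType boolean := boolean_semimod corner_idem.

Fact to_cornerP (x : N) : corner_pred (w *: x).
Proof. by rewrite /corner_pred scalerA ww. Qed.
Definition to_corner (x : N) : corner_mod := Corner (to_cornerP x).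

End Corner.

Section CornerMap.
Variables (N N' : lSemiModType R) (f : {linear N -> N'}).
Fact corner_mapP (x : corner N) : corner_pred (f (cval x)).
Proof. by rewrite /corner_pred -linearZ cornerE. Qed.
Definition corner_map_fun (x : corner_mod N) : corner_mod N' := Corner (corner_mapP x).
Fact corner_map0 : corner_map_fun 0 = 0.
Proof. by apply: val_inj; rewrite /= raddf0. Qed.
Fact corner_mapD : {morph corner_map_fun : x y / x + y}.
Proof. by move=> x y; apply: val_inj; rewrite /= raddfD. Qed.
Definition corner_map : {linear corner_mod N -> corner_mod N'} :=
  boolean_linear corner_map0 corner_mapD.
End CornerMap.

Fact corner_map1 (N : semimodules R) :
  corner_map (mor_id N) = mor_id (corner_mod N : semimodules boolean).
Proof. by apply: linear_ext => x; apply: val_inj. Qed.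
Fact corner_mapM (N N' N'' : semimodules R) (g : mor N' N'') (f : mor N N') :
  corner_map (mor_comp g f) =
  mor_comp (corner_map g : @mor (semimodules boolean) _ _) (corner_map f).
Proof. by apply: linear_ext => x; apply: val_inj. Qed.

Definition corner_functor : functor (semimodules R) (semimodules boolean) :=
  @Functor (semimodules R) (semimodules boolean) corner_mod corner_map
    corner_map1 corner_mapM.

(* Additive maps from the right ideal w R to L, extended to R along x |-> w x;
   this is the coinduced semimodule Hom(w R, L). *)
Section Coinduced.
Variable L : lSemiModType boolean.

Record coind := Coind {
  coind_fun :> R -> L;
  coind_0 : coind_fun 0 = 0;
  coind_D : {morph coind_fun : x y / x + y};
  coind_w : forall x, coind_fun (w * x) = coind_fun x
}.

Lemma coind_ext (f g : coind) : f =1 g -> f = g.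
Proof.
case: f g => [f f0 fD fw] [g g0 gD gw] /= /funext fg.
by case: g / fg g0 gD gw => *; congr Coind; apply: Prop_irrelevance.
Qed.

HB.instance Definition _ := gen_eqMixin coind.
HB.instance Definition _ := gen_choiceMixin coind.

Definition coind_zero : coind :=
  @Coind (fun=> 0) erefl (fun _ _ => esym (addr0 0)) (fun=> erefl).

Fact coind_add_subproof (f g : coind) :
  [/\ f 0 + g 0 = 0,
      {morph (fun x => f x + g x) : x y / x + y} &
      forall x, f (w * x) + g (w * x) = f x + g x].
Proof.
split=> [|x y|x]; rewrite ?coind_0 ?addr0 // ?coind_w //.
by rewrite !coind_D addrACA.
Qed.
Definition coind_add (f g : coind) : coind :=
  let: And3 h0 hD hw := coind_add_subproof f g in Coind h0 hD hw.

Lemma coind_addE f g x : coind_add f g x = f x + g x.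
Proof. by rewrite /coind_add; case: coind_add_subproof. Qed.

Fact coind_addA : associative coind_add.
Proof. by move=> f g h; apply: coind_ext => x; rewrite !coind_addE addrA. Qed.
Fact coind_addC : commutative coind_add.
Proof. by move=> f g; apply: coind_ext => x; rewrite !coind_addE addrC. Qed.
Fact coind_add0 : left_id coind_zero coind_add.
Proof. by move=> f; apply: coind_ext => x; rewrite coind_addE /= add0r. Qed.
HB.instance Definition _ :=
  GRing.isNmodule.Build coind coind_addA coind_addC coind_add0.

Fact coind_scale_subproof (r : R) (f : coind) :
  [/\ f (0 * r) = 0,
      {morph (fun x => f (x * r)) : x y / x + y} &
      forall x, f (w * x * r) = f (x * r)].
Proof.
split=> [|x y|x]; first by rewrite mul0r coind_0.
  by rewrite mulrDl coind_D.
by rewrite -mulrA coind_w.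
Qed.
Definition coind_scale (r : R) (f : coind) : coind :=
  let: And3 h0 hD hw := coind_scale_subproof r f in Coind h0 hD hw.

Lemma coind_scaleE r f x : coind_scale r f x = f (x * r).
Proof. by rewrite /coind_scale; case: coind_scale_subproof. Qed.

Fact coind_scaleA r s f : coind_scale r (coind_scale s f) = coind_scale (r * s) f.
Proof. by apply: coind_ext => x; rewrite !coind_scaleE mulrA. Qed.
Fact coind_scale0 f : coind_scale 0 f = 0.
Proof. by apply: coind_ext => x; rewrite coind_scaleE mulr0 coind_0. Qed.
Fact coind_scale1 : left_id 1 coind_scale.
Proof. by move=> f; apply: coind_ext => x; rewrite coind_scaleE mulr1. Qed.
Fact coind_scaleDr : right_distributive coind_scale +%R.
Proof.
move=> r f g; apply: coind_ext => x.
by rewrite [RHS]coind_addE !coind_scaleE [LHS]coind_addE.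
Qed.
Fact coind_scaleDl f : {morph coind_scale^~ f : r s / r + s}.
Proof.
move=> r s; apply: coind_ext => x.
by rewrite [RHS]coind_addE !coind_scaleE mulrDr coind_D.
Qed.
HB.instance Definition _ := GRing.Nmodule_isLSemiModule.Build R coind
  coind_scaleA coind_scale0 coind_scale1 coind_scaleDr coind_scaleDl.
End Coinduced.

Section CoindMap.
Variables (L L' : lSemiModType boolean) (g : {linear L -> L'}).
Fact coind_map_subproof (f : coind L) :
  [/\ g (f 0) = 0, {morph g \o f : x y / x + y} & forall x, g (f (w * x)) = g (f x)].
Proof.
split=> [|x y|x]; first by rewrite coind_0 raddf0.
  by rewrite /= coind_D raddfD.
by rewrite coind_w.
Qed.
Definition coind_map_fun (f : coind L) : coind L' :=
  let: And3 h0 hD hw := coind_map_subproof f in @Coind _ (g \o f) h0 hD hw.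

Lemma coind_mapE f x : coind_map_fun f x = g (f x).
Proof. by rewrite /coind_map_fun; case: coind_map_subproof. Qed.

Fact coind_map_semilinear : semilinear_for *:%R coind_map_fun.
Proof.
split=> [r f|f h]; apply: coind_ext => x.
  by rewrite coind_mapE [LHS]/(g _) !coind_scaleE coind_mapE.
by rewrite coind_mapE [RHS]coind_addE !coind_mapE [f + h]/(coind_add f h) coind_addE raddfD.
Qed.
Definition coind_map : {linear coind L -> coind L'} :=
  HB.pack coind_map_fun (GRing.isSemilinear.Build R (coind L) (coind L') *:%R
    coind_map_fun coind_map_semilinear).
End CoindMap.

Fact coind_map1 (L : semimodules boolean) :
  coind_map (mor_id L) = mor_id (coind L : semimodules R).
Proof. by apply: linear_ext => f; apply: coind_ext => x; rewrite coind_mapE. Qed.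
Fact coind_mapM (L L' L'' : semimodules boolean) (g : mor L' L'') (f : mor L L') :
  coind_map (mor_comp g f) =
  mor_comp (coind_map g : @mor (semimodules R) _ _) (coind_map f).
Proof.
by apply: linear_ext => h; apply: coind_ext => x; rewrite /= !coind_mapE.
Qed.

Definition coind_functor : functor (semimodules boolean) (semimodules R) :=
  @Functor (semimodules boolean) (semimodules R) (fun L => coind L) coind_map
    coind_map1 coind_mapM.

(** Invariance under [w] on the left comes from coinduction and on the right from [w *: f = f], so
    the value at [x] is that at [w * x * w], which is 0 or [w]; the values at [w] and at 1 agree. *)
Lemma coind_eval (L : lSemiModType boolean) (f : corner_mod (coind L)) (x : R) :
  cval f x = if w * x * w == 0 then 0 else cval f 1.
Proof.
have fw y : cval f (y * w) = cval f y by rewrite -{2}(cornerE f) coind_scaleE.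
have -> : cval f x = cval f (w * x * w) by rewrite fw coind_w.
have [->|->] := wP x; first by rewrite eqxx coind_0.
case: eqP => [->|_]; first by rewrite coind_0.
by rewrite -[w]mulr1 coind_w.
Qed.

Section CornerCoind.
Variable L : lSemiModType boolean.

Definition eval_one (f : corner_mod (coind L)) : L := cval f 1.
Fact eval_one0 : eval_one 0 = 0. Proof. by []. Qed.
Fact eval_oneD : {morph eval_one : f g / f + g}.
Proof. by move=> f g; apply: coind_addE. Qed.
Definition eval_one_linear : {linear corner_mod (coind L) -> L} :=
  boolean_linear eval_one0 eval_oneD.

(** By [coind_eval], this is the only candidate for an element of the corner with value [l] at 1.
    Additivity holds because sums with a nonzero term are nonzero and [l + l = l]. *)
Fact char_fun_subproof (l : L) :
  let f x := if w * x * w == 0 then 0 else l in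
  [/\ f 0 = 0, {morph f : x y / x + y} & forall x, f (w * x) = f x].
Proof.
split=> [|x y|x]; rewrite ?mulr0 ?mul0r ?eqxx //; last by rewrite mulrA ww.
rewrite mulrDr mulrDl; set p := w * x * w; set q := w * y * w.
have [->|p0] := eqVneq p 0; first by rewrite !add0r.
have /negPf -> : p + q != 0.
  by apply/eqP => /(addr_eq0l one_neq0 simR w_inf)/eqP; apply/negP.
by case: eqP => _; rewrite ?addr0 ?boolean_idem.
Qed.
Definition char_fun (l : L) : coind L :=
  let: And3 h0 hD hw := char_fun_subproof l in Coind h0 hD hw.

Lemma char_funE l x : char_fun l x = if w * x * w == 0 then 0 else l.
Proof. by rewrite /char_fun; case: char_fun_subproof. Qed.

Fact char_fun_corner l : corner_pred (char_fun l).
Proof.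
apply/eqP/coind_ext => x; rewrite [LHS]coind_scaleE !char_funE.
by rewrite !mulrA -[_ * w * w]mulrA ww.
Qed.

Lemma eval_one_isom :
  @is_isom (semimodules boolean) (corner_mod (coind L)) L eval_one_linear.
Proof.
pose g (l : L) : corner_mod (coind L) := Corner (char_fun_corner l).
have fK : cancel eval_one_linear g.
  by move=> f; apply/val_inj/coind_ext => x; rewrite /= char_funE [RHS]coind_eval.
have gK : cancel g eval_one_linear.
  by move=> l; rewrite /= /eval_one /= char_funE mulr1 ww (negPf (inf_neq0 one_neq0 w_inf)).
exact: bijective_is_isom fK gK.
Qed.
End CornerCoind.

Section CoindCorner.
Variable N : lSemiModType R.

Definition orbit_map (y : N) : coind (corner_mod N).
Proof.
apply: (@Coind _ (fun x => to_corner (x *: y))) => [|x x'|x]; apply: val_inj.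
- by rewrite /= scale0r scaler0.
- by rewrite raddfD /= scalerDl scalerDr.
- by rewrite /= !scalerA mulrA ww.
Defined.

(** Inverse of [orbit_map]: as [y] is the sum of the [a i *: (w *: (b i *: y))], it is recovered
    from the values of its orbit map at the [b i]. *)
Definition coind_sum (f : coind (corner_mod N)) : N :=
  \sum_(i < n) a i *: cval (f (b i)).

Fact orbit_map_semilinear : semilinear_for *:%R orbit_map.
Proof.
split=> [r x|x y]; apply: coind_ext => s; apply: val_inj.
  by rewrite [in RHS]coind_scaleE /= !scalerA mulrA.
by rewrite [in RHS]coind_addE raddfD /= !scalerDr.
Qed.
Definition orbit_linear : {linear N -> coind (corner_mod N)} :=
  HB.pack orbit_map (GRing.isSemilinear.Build R N (coind (corner_mod N)) *:%R
    orbit_map orbit_map_semilinear).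

Lemma orbit_mapK : cancel orbit_map coind_sum.
Proof.
move=> y; rewrite /coind_sum /= -[RHS]scale1r one_sum scaler_suml.
by apply: eq_bigr => i _; rewrite !scalerA.
Qed.

(** Expand [w * x] as the sum of the [(w * x * a i * w) * b i]. Each coefficient is 0 or [w], and
    [f] commutes with both, so [f] is determined by its values at the [b i]. *)
Lemma coind_sumK : cancel coind_sum orbit_map.
Proof.
move=> f; apply: coind_ext => x; rewrite -[RHS]coind_w.
apply: val_inj; rewrite /= scalerA /coind_sum scaler_sumr.
have {2}-> : w * x = \sum_(i < n) (w * x * a i * w) * b i.
  by rewrite -[LHS]mulr1 one_sum mulr_sumr; apply: eq_bigr => i _; rewrite !mulrA.
have fsum : {morph (fun z => cval (f z)) : x y / x + y}.
  by move=> z z'; rewrite coind_D; exact: (raddfD (val : corner N -> N)).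
rewrite (big_morph _ fsum (congr1 (@cval N) (coind_0 f))).
apply: eq_bigr => i _; rewrite scalerA -{1}(cornerE (f (b i))) scalerA.
rewrite -[w * x * a i]mulrA.
have [->|->] := wP (x * a i); first by rewrite scale0r mul0r coind_0.
by rewrite cornerE coind_w.
Qed.
End CoindCorner.

Definition coind_sum_linear (N : lSemiModType R) : {linear coind (corner_mod N) -> N} :=
  @linear_inverse R _ _ (orbit_linear N) _ (@orbit_mapK N) (@coind_sumK N).

Lemma coind_sum_natural (N N' : lSemiModType R) (f : {linear N -> N'})
    (h : coind (corner_mod N)) :
  coind_sum (coind_map (corner_map f) h) = f (coind_sum h).
Proof.
rewrite /coind_sum linear_sum; apply: eq_bigr => i _.
by rewrite linearZ [coind_map _ h _]coind_mapE.
Qed.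

Lemma ideal_simple_infinite_morita : morita_equivalent R boolean.
Proof.
exists corner_functor, coind_functor; split.
  exists coind_sum_linear; split=> [N N' f|N].
    by apply: linear_ext => h; apply: coind_sum_natural.
  apply: (@bijective_is_isom _ _ _ (coind_sum_linear N) (orbit_map (N := N))).
    exact: coind_sumK.
  exact: orbit_mapK.
exists eval_one_linear; split=> [L L' g|L]; last exact: eval_one_isom.
by apply: linear_ext => f; rewrite /= /eval_one /= coind_mapE.
Qed.

End Morita.

(** * Transport of strong generators along an equivalence *)

Section Equivalences.
Variables (C D : category) (F : functor C D) (G : functor D C).

Lemma equivalence_faithful (A B : C) :
  naturally_isomorphic (functor_comp G F) (functor_id C) ->
  injective (@fmap C D F A B).
Proof.
case=> phi [nat iso] f g E; have [p [_ pK]] := iso A.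
have recover (h : mor A B) : h = mor_comp (mor_comp (phi B) (fmap G (fmap F h))) p.
  by have /= -> := nat _ _ h; rewrite -mor_compA pK mor_compm1.
by rewrite (recover f) (recover g) E.
Qed.

Lemma equivalence_full (A B : C) :
  naturally_isomorphic (functor_comp G F) (functor_id C) ->
  naturally_isomorphic (functor_comp F G) (functor_id D) ->
  forall h : mor (F A) (F B), exists f : mor A B, fmap F f = h.
Proof.
move=> isoGF isoFG h; have [phi [nat iso]] := isoGF.
have [p [pK Kp]] := iso A; have [q [qK _]] := iso B.
(* This is [fmap G h] conjugated by the natural isomorphism; its image under [F] agrees with [h]
   after applying [G], which is faithful. *)
exists (mor_comp (mor_comp (phi B) (fmap G h)) p).
have GFG : injective (@fmap _ _ G (F A) (F B)).
  case: isoFG => psi [natD isoD] f g E; have [s [_ sK]] := isoD (F A).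
  have recover (k : mor (F A) (F B)) :
      k = mor_comp (mor_comp (psi (F B)) (fmap F (fmap G k))) s.
    by have /= -> := natD _ _ k; rewrite -mor_compA sK mor_compm1.
  by rewrite (recover f) (recover g) E.
apply: GFG; set f := mor_comp _ p.
have E : mor_comp (phi B) (fmap G (fmap F f)) = mor_comp (phi B) (fmap G h).
  by have /= -> := nat _ _ f; rewrite /f -mor_compA pK mor_compm1.
have /(congr1 (mor_comp q)) := E.
by rewrite !mor_compA qK !mor_comp1m.
Qed.

End Equivalences.

(** Bijectivity of Hom([B], [m]) makes [m] invertible: the right inverse [n] is again bijective on
    morphisms from [B], so it has a right inverse in turn. *)
Definition strong_generator (C : category) (B : C) : Prop :=
  forall (Z X : C) (m : mor Z X),
    (forall u v : mor B Z, mor_comp m u = mor_comp m v -> u = v) ->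
    (forall u : mor B X, exists t : mor B Z, mor_comp m t = u) ->
    exists n : mor X Z, mor_comp m n = mor_id X.

(** Morphisms from [G B] to [Z] correspond to morphisms from [B] to [F Z], so the hypotheses pass
    from [m] to [fmap F m]; by fullness and faithfulness a section of [fmap F m] comes from one of
    [m]. *)
Lemma strong_generator_equivalence (C D : category) (F : functor C D)
    (G : functor D C) (B : D) :
  naturally_isomorphic (functor_comp G F) (functor_id C) ->
  naturally_isomorphic (functor_comp F G) (functor_id D) ->
  strong_generator B -> strong_generator (G B).
Proof.
move=> isoGF isoFG genB Z X m inj surj.
have [phi [nat iso]] := isoGF; have [p [pK Kp]] := iso Z; have [q [qK Kq]] := iso X.
have natm : mor_comp (phi X) (fmap G (fmap F m)) = mor_comp m (phi Z) := nat _ _ m.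
have [n mn] : exists n : mor (F X) (F Z), mor_comp (fmap F m) n = mor_id (F X).
  apply: genB => [u v E|u].
    apply: (equivalence_faithful isoFG).
    have : mor_comp (phi Z) (fmap G u) = mor_comp (phi Z) (fmap G v).
      by apply: inj; rewrite !mor_compA -natm -!mor_compA -!fmapM E.
    by move=> /(congr1 (mor_comp p)); rewrite !mor_compA pK !mor_comp1m.
  have [t mt] := surj (mor_comp (phi X) (fmap G u)).
  have [v Ev] := equivalence_full isoFG isoGF (mor_comp p t).
  exists v; apply: (equivalence_faithful isoFG); rewrite fmapM Ev.
  have : mor_comp (phi X) (mor_comp (fmap G (fmap F m)) (mor_comp p t)) =
         mor_comp (phi X) (fmap G u).
    rewrite mor_compA natm -mt -[mor_comp m t in RHS]mor_compm1.
    by rewrite -!mor_compA [mor_comp (phi Z) _]mor_compA Kp mor_comp1m mor_compm1.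
  by move=> /(congr1 (mor_comp q)); rewrite !mor_compA qK !mor_comp1m.
have [k Ek] := equivalence_full isoGF isoFG n.
exists k; apply: (equivalence_faithful isoGF).
by rewrite fmapM Ek mn fmap1.
Qed.

Section BooleanGenerator.

Definition point (X : lSemiModType boolean) (x : X) : {linear boolean^o -> X} :=
  @boolean_linear boolean^o X (fun c => c *: x) (scale0r x) (scalerDl x).

Lemma point_eq (X : lSemiModType boolean) (u : {linear boolean^o -> X}) :
  u = point (u 1).
Proof.
apply: linear_ext => c; rewrite /= -linearZ; congr (u _).
by rewrite -[c in LHS]mulr1.
Qed.

Lemma point_inj (X : lSemiModType boolean) : injective (@point X).
Proof.
move=> x y /(congr1 (fun u : {linear boolean^o -> X} => u 1)) /=.
by rewrite !scale1r.
Qed.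

(** Morphisms from the regular semimodule are elements, so [m] is bijective. *)
Lemma boolean_strong_generator :
  @strong_generator (semimodules boolean) (boolean^o : lSemiModType boolean).
Proof.
move=> Z X m inj surj.
have m_inj : injective (m : {linear _ -> _}).
  move=> x y E; apply: point_inj; apply: inj; apply: linear_ext => c.
  by rewrite /= !linearZ E.
have preim (x : X) : exists z : Z, (m : {linear _ -> _}) z = x.
  have [t E] := surj (point x); exists ((t : {linear _ -> _}) 1).
  have := congr1 (fun u : {linear boolean^o -> _} => u 1) E.
  by rewrite /= scale1r.
have [g gK] := choice preim.
have fK : cancel (m : {linear _ -> _}) g by move=> x; apply: m_inj; rewrite gK.
by have [n [_ mn]] := bijective_is_isom fK gK; exists n.
Qed.

End BooleanGenerator.

(** * Trace ideals and semimodules whose only endomorphisms are the identity and zero *)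

Section TraceIdeal.
Variables (R : pzSemiRingType) (Q : lSemiModType R).

Definition in_trace (x : R^o) : Prop :=
  exists s : seq ({linear Q -> R^o} * Q), x = \sum_(p <- s) p.1 p.2.
Definition trace_pred : pred R^o := fun x => `[< in_trace x >].

Fact trace_closed : subsemimod_closed trace_pred.
Proof.
split; first split.
- by apply/asboolP; exists [::]; rewrite big_nil.
- move=> x y /asboolP [s ->] /asboolP [t ->]; apply/asboolP.
  by exists (s ++ t); rewrite big_cat.
- move=> r x /asboolP [s ->]; apply/asboolP.
  exists [seq (p.1, r *: p.2) | p <- s].
  by rewrite big_map scaler_sumr; apply: eq_bigr => p _; rewrite linearZ.
Qed.

Record trace := Trace { tval :> R^o; tvalP : trace_pred tval }.
HB.instance Definition _ := [isSub for tval].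
HB.instance Definition _ := [Choice of trace by <:].
HB.instance Definition _ :=
  GRing.SubChoice_isSubLSemiModule.Build R R^o trace_pred trace trace_closed.

(** Every linear form on [Q] takes values in the trace, so the inclusion of the trace in [R] has a
    right inverse and the trace contains 1. *)
Lemma strong_generator_trace : @strong_generator (semimodules R) Q ->
  exists s : seq ({linear Q -> R^o} * Q), 1 = \sum_(p <- s) p.1 p.2.
Proof.
move=> genQ; pose m : {linear trace -> R^o} := val.
have [||n mn] := genQ trace R^o m.
- move=> u v E; apply: linear_ext => q; apply: val_inj.
  exact: (congr1 (fun f : {linear Q -> R^o} => f q) E).
- move=> u; have uP q : trace_pred ((u : {linear Q -> R^o}) q).
    by apply/asboolP; exists [:: (u : {linear Q -> R^o}, q)]; rewrite big_seq1.
  pose t q := Trace (uP q).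
  have tL : semilinear_for *:%R t.
    split=> [r x|x y]; apply: val_inj; rewrite /= ?linearZ ?linearD //.
  pose T : {linear Q -> trace} :=
    HB.pack t (GRing.isSemilinear.Build R Q trace *:%R t tL).
  by exists T; apply: linear_ext.
have E : val ((n : {linear R^o -> trace}) 1) = 1.
  exact: (congr1 (fun f : {linear R^o -> R^o} => f 1) mn).
by have /asboolP := tvalP ((n : {linear R^o -> trace}) 1); rewrite -[tval _]/(val _) E.
Qed.

End TraceIdeal.

Section BooleanProgenerator.
Variables (R : pzSemiRingType) (Q : lSemiModType R).
Hypothesis endQ : forall h : {linear Q -> Q}, h =1 id \/ h =1 (fun=> 0).
Hypothesis idemQ : forall q : Q, q + q = q.
Variable s : seq ({linear Q -> R^o} * Q).
Hypothesis one_trace : (1 : R) = \sum_(p <- s) p.1 p.2.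

Lemma dyad_dichotomy (u : {linear Q -> R^o}) (q : Q) :
  (forall x, (u x : R) *: q = x) \/ (forall x, (u x : R) *: q = 0).
Proof.
have hL : semilinear_for *:%R (fun x => (u x : R) *: q).
  by split=> [r x|x y]; rewrite ?linearZ ?linearD ?scalerA // scalerDl.
exact: (endQ (HB.pack (fun x => (u x : R) *: q)
  (GRing.isSemilinear.Build R Q Q *:%R (fun x => (u x : R) *: q) hL))).
Qed.

(** Write [r = 1 * r * 1] and expand both units; linearity turns [u q * r * u' q'] into
    [u' (u q *: (r *: q'))]. *)
Lemma trace_expand (r : R) :
  r = \sum_(p <- s) \sum_(p' <- s) (p'.1 ((p.1 p.2 : R) *: (r *: p'.2)) : R).
Proof.
rewrite -[LHS]mul1r one_trace mulr_suml; apply: eq_bigr => p _.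
rewrite -[X in _ * X = _]mulr1 {1}one_trace !mulr_sumr; apply: eq_bigr => p' _.
by rewrite !linearZ.
Qed.

(** In [trace_expand], the argument of each [p'.1] is either [p.2] or 0 by the dichotomy, so the
    term is absorbed by [p'.1 p.2], whatever [r] is. *)
Lemma progenerator_infinite : exists infty : R, is_infinite infty.
Proof.
exists (\sum_(p <- s) \sum_(p' <- s) (p'.1 p.2 : R)) => r.
have idemR (x : R) : x + x = x.
  suff E : 1 + 1 = 1 :> R by rewrite -[x]mul1r -mulrDl E.
  rewrite one_trace -big_split; apply: eq_bigr => p _ /=.
  by rewrite -[RHS](congr1 p.1 (idemQ p.2)) linearD.
rewrite {1}[r]trace_expand -big_split; apply: eq_bigr => p _ /=.
rewrite -big_split; apply: eq_bigr => p' _ /=.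
have [->|->] := dyad_dichotomy p.1 (r *: p'.2); first exact: idemR.
by rewrite linear0 add0r.
Qed.

Lemma progenerator_ideal_simple : ideal_simple R.
Proof.
move=> I idI; have [I0 ID IMl IMr] := idI.
have [[r Ir r0]|none] := pselect (exists2 r, I r & r <> 0); last first.
  left; apply/funext => x; apply/propext; split=> [Ix|->//].
  by apply: contrapT => x0; apply: none; exists x.
right; apply/funext => x; apply/propext; split=> // _.
suff I1 : I 1 by rewrite -[x]mulr1; apply: IMl.
have [q rq0] : exists q : Q, r *: q <> 0.
  apply: contrapT => none; apply: r0; rewrite -[r]mulr1 one_trace mulr_sumr.
  rewrite big1 // => p _; rewrite -[LHS]/(r *: p.1 p.2) -linearZ.
  have -> : r *: p.2 = 0 by apply: contrapT => h; apply: none; exists p.2.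
  exact: linear0.
(* If every form of the decomposition of 1 gave the zero map, then [r *: q = 1 *: (r *: q)] would
   vanish. *)
have [u uP] : exists u : {linear Q -> R^o}, forall x, (u x : R) *: (r *: q) = x.
  apply: contrapT => none; apply: rq0; rewrite -[LHS]scale1r one_trace scaler_suml.
  rewrite big1 // => p _; have [h|->//] := dyad_dichotomy p.1 (r *: q).
  by case: none; exists p.1.
(* Replacing [p.2] by [u p.2 *: (r *: q)] turns each term of 1 into [u p.2 * (r * p.1 q)], which
   lies in [I]. *)
rewrite one_trace; apply: ideal_sum => // p _.
by rewrite -[p.2 in X in I X]uP !linearZ; apply/IMl/IMr.
Qed.

End BooleanProgenerator.

(** The chain 0 < 1 < 2 under [max]: a semimodule over the Booleans whose number of elements is not
    a power of 2. *)
Definition chain3 : Type := 'I_3.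
HB.instance Definition _ := Choice.on chain3.
Fact chain3_add0 : left_id (ord0 : chain3) (Order.max : chain3 -> chain3 -> chain3).
Proof. by move=> x; apply/max_idPr. Qed.
HB.instance Definition _ := GRing.isNmodule.Build chain3
  (@maxA _ 'I_3) (@maxC _ 'I_3) chain3_add0.
Definition chain3_mod : lSemiModType boolean := boolean_semimod (@maxxx _ 'I_3 : forall x : chain3, x + x = x).

Lemma boolean_endo (h : {linear boolean^o -> boolean^o}) : h = idfun \/ h = \0.
Proof.
rewrite (point_eq h); case: (h 1 : bool); [left|right]; apply: linear_ext => c.
  exact: mulr1.
exact: mulr0.
Qed.

(** * The image of the regular Boolean semimodule under an equivalence *)

Section EquivalenceProgenerator.
Variables (R : pzSemiRingType).
Variables (F : functor (semimodules R) (semimodules boolean)).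
Variables (G : functor (semimodules boolean) (semimodules R)).
Hypothesis isoGF : naturally_isomorphic (functor_comp G F) (functor_id _).
Hypothesis isoFG : naturally_isomorphic (functor_comp F G) (functor_id _).

Let B : semimodules boolean := (boolean^o : lSemiModType boolean).
Let Q : lSemiModType R := G B.
Let z : mor B B := (\0 : {linear boolean^o -> boolean^o}).

Let fmapG_inj (X Y : semimodules boolean) : injective (@fmap _ _ G X Y).
Proof. exact: equivalence_faithful isoFG. Qed.

(** Functors here carry no additivity, so this needs an argument: by fullness the zero map of [Q]
    comes from the identity or from zero. The first would make [Q] trivial and [G] identify the two,
    against faithfulness. *)
Lemma fmap_zero : fmap G z = (\0 : {linear Q -> Q}).
Proof.
have [f Ef] := equivalence_full isoFG isoGF (\0 : {linear Q -> Q}).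
have [f1|f0] := boolean_endo f; last by rewrite -Ef f0.
have : fmap G z = fmap G (mor_id B).
  have id0 : (\0 : {linear Q -> Q}) = semimod_id Q by rewrite -Ef f1; exact: (fmap1 G B).
  apply: linear_ext => x.
  have Ex y : y = 0 :> Q by exact/esym/(congr1 (fun h : {linear Q -> Q} => h y) id0).
  by rewrite [LHS]Ex [RHS]Ex.
move=> /fmapG_inj /(congr1 (fun h : {linear boolean^o -> boolean^o} => h 1)).
by [].
Qed.

Lemma image_endo (h : {linear Q -> Q}) : h =1 id \/ h =1 (fun=> 0).
Proof.
have [f <-] := equivalence_full isoFG isoGF h.
have [->|->] := boolean_endo f; [left|right] => x.
  by rewrite -[fmap G _]/(fmap G (mor_id B)) fmap1.
by rewrite -[fmap G _]/(fmap G z) fmap_zero.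
Qed.

Lemma image_nonzero : exists q : Q, q <> 0.
Proof.
apply: contrapT => none.
have Ex (y : Q) : y = 0 by apply: contrapT => h; apply: none; exists y.
have : fmap G z = fmap G (mor_id B).
  by apply: linear_ext => x; rewrite [LHS]Ex [RHS]Ex.
by move=> /fmapG_inj /(congr1 (fun h : {linear boolean^o -> boolean^o} => h 1)).
Qed.

(* Otherwise Q has exponent 2, and so would Hom(Q, G chain3), a set with exactly
   three elements. *)
Lemma image_idem (q : Q) : q + q = q.
Proof.
have [h|h] := image_endo (idfun \+ idfun : {linear Q -> Q}); first exact: h.
have exp2 (x : Q) : x + x = 0 by apply: h.
pose X := chain3_mod.
pose e (k : X) : {linear Q -> G X} := fmap G (point k : @mor (semimodules boolean) B X).
have e_inj : injective e by move=> k l /fmapG_inj /point_inj.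
have e2 k x : e k x + e k x = 0 by rewrite -linearD exp2 linear0.
have e_surj (g : {linear Q -> G X}) : exists k, g = e k.
  have [f Ef] := equivalence_full isoFG isoGF g.
  by exists ((f : {linear boolean^o -> X}) 1); rewrite /e -point_eq.
have e0 x : e 0 x = 0.
  have E : (e 0 : mor (G B) (G X)) = mor_comp (e 0 : mor (G B) (G X)) (fmap G z).
    rewrite /e -fmapM; congr (fmap G _); apply: linear_ext => c.
    by rewrite /= !scaler0.
  rewrite (congr1 (fun h : {linear Q -> G X} => h x) E) fmap_zero.
  exact: linear0.
have neq k l : k <> l -> ~ (forall x, e k x = e l x).
  by move=> kl E; apply: kl; apply: e_inj; apply: linear_ext.
pose k1 : X := Ordinal (isT : (1 < 3)%N); pose k2 : X := Ordinal (isT : (2 < 3)%N).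
have k10 : k1 <> 0 by move=> /(congr1 (@nat_of_ord 3)).
have k20 : k2 <> 0 by move=> /(congr1 (@nat_of_ord 3)).
have k12 : k1 <> k2 by move=> /(congr1 (@nat_of_ord 3)).
have kP (k : X) : [\/ k = 0, k = k1 | k = k2].
  by case: k => [[|[|[|k]]] //= lt_k]; [apply: Or31|apply: Or32|apply: Or33];
    apply: (val_inj : injective (@nat_of_ord 3)).
have [k Ek] := e_surj (e k1 \+ e k2 : {linear Q -> G X}).
have {}Ek x : e k1 x + e k2 x = e k x.
  exact: (congr1 (fun h : {linear Q -> G X} => h x) Ek).
have [kE|kE|kE] := kP k; rewrite kE in Ek; exfalso.
- apply: (neq _ _ k12) => x; have := Ek x; rewrite e0 => /(congr1 (+%R^~ (e k2 x))).
  by rewrite -addrA e2 addr0 add0r.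
- apply: (neq _ _ k20) => x; rewrite e0.
  by have := congr1 (+%R (e k1 x)) (Ek x); rewrite addrA e2 add0r.
- apply: (neq _ _ k10) => x; rewrite e0.
  by have := congr1 (+%R^~ (e k2 x)) (Ek x); rewrite -addrA e2 addr0.
Qed.

End EquivalenceProgenerator.

Lemma morita_boolean_ideal_simple (R : pzSemiRingType) : morita_equivalent R boolean ->
  [/\ (1 : R) <> 0, ideal_simple R & exists infty : R, is_infinite infty].
Proof.
move=> [F [G [isoGF isoFG]]].
have [s one_trace] := strong_generator_trace
  (strong_generator_equivalence isoGF isoFG boolean_strong_generator).
have endQ := image_endo isoGF isoFG.
have [q q0] := image_nonzero isoFG.
split.
- by move=> E; apply: q0; rewrite -[q]scale1r E scale0r.
- exact: progenerator_ideal_simple endQ s one_trace.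
- exact: progenerator_infinite endQ (image_idem isoGF isoFG) s one_trace.
Qed.

(** * The cycle of implications between the four conditions *)

Theorem theorem5p7 (R : pzSemiRingType) :
  [<-> simple_semiring R /\ (exists infty : R, is_infinite infty);
       morita_equivalent R boolean;
       exists (d : Order.disp_t) (M : finTBDistrLatticeType d),
         (exists x : M, x != \bot%O) /\ semiring_iso R (join_endo M);
       complete_semiring R /\ simple_semiring R].
Proof.
tfae.
- move=> [[one_neq0 simR _] [w w_inf]].
  have [n [a [b E]]] := inf_factorization one_neq0 simR w_inf.
  exact: ideal_simple_infinite_morita one_neq0 simR w_inf _ _ _ E.
- move=> /morita_boolean_ideal_simple [one_neq0 simR [w w_inf]].
  exact: ideal_simple_infinite_endo one_neq0 simR w_inf.
- move=> [d [M [M0 [f [g fK gK]]]]]; split.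
    exact: (complete_iso fK gK (endo_complete M)).
  exact: (simple_iso fK gK (endo_simple M0)).
- move=> [[sum sumP] simR]; split=> //.
  by exists (sum (R * nat)%type (fun p => p.1)); exact: complete_infinite sumP.
Qed.
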